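(* For every integer $k\ge 3$, there are no $k$-pockets in the Cayley graph of Thompson's group $F$ with respect to the generating set $\{x_0,x_1\}$; that is, there is no element $w\in F$ such that $B_w(k)\subset B_{id}(n)$, where $n=|w|$.
   Context: Thompson's group $F$ is the group $\langle x_0,x_1\mid [x_0x_1^{-1},x_0^{-1}x_1x_0],[x_0x_1^{-1},x_0^{-2}x_1x_0^2]\rangle$, equivalently $\langle x_k,\ k\ge 0 \mid x_i^{-1}x_jx_i=x_{j+1}\ \text{for } i<j\rangle$. $|w|$ denotes word length with respect to $\{x_0^{\pm1},x_1^{\pm1}\}$, and $d(f,g)=|f^{-1}g|$. For $g\in F$ and an integer $k\geq 0$, $B_g(k)=\{h\in F: d(g,h)\le k\}$ is the ball of radius $k$ centered at $g$ in the Cayley graph. For $k>0$, an element $w\in F$ with $|w|=n$ defines a $k$-pocket if $B_w(k)\subset B_{id}(n)$, i.e. all paths of length $k$ in the Cayley graph emanating from $w$ remain in the ball of radius $n$ centered at the identity. *)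

(* Defs.v *)
From HB Require Import structures.
From mathcomp Require Import all_boot.
From mathcomp Require Import boolp classical_sets.

Set Implicit Arguments.
Unset Strict Implicit.
Unset Printing Implicit Defensive.

Local Open Scope quotient_scope.

(* The group < I | R >: words in the letters x_i and x_i^-1, modulo the       *)
(* smallest congruence that cancels adjacent inverse letters and trivializes  *)
(* every word of R.  The letter (i, false) is x_i and (i, true) is x_i^-1.    *)
Section Presentation.
Variable I : choiceType.

Definition letter : Type := (I * bool)%type.
Definition word : Type := seq letter.

Definition inv_letter (l : letter) : letter := (l.1, ~~ l.2).
Definition inv_word (u : word) : word := rev (map inv_letter u).
Definition comm_word (u v : word) : word :=
  inv_word u ++ inv_word v ++ u ++ v.

Variable R : word -> Prop.

Inductive word_eq : word -> word -> Prop :=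
| word_eq_refl u : word_eq u u
| word_eq_sym u v : word_eq u v -> word_eq v u
| word_eq_trans u v w : word_eq u v -> word_eq v w -> word_eq u w
| word_eq_cat u u' v v' :
    word_eq u u' -> word_eq v v' -> word_eq (u ++ v) (u' ++ v')
| word_eq_cancel l : word_eq [:: l; inv_letter l] [::]
| word_eq_rel r : R r -> word_eq r [::].

Definition word_eqb : rel word := fun u v => `[< word_eq u v >].

Lemma word_eqb_equiv : equiv_class_of word_eqb.
Proof.
split=> [u|u v|v u w].
- exact/asboolP/word_eq_refl.
- by apply/asboolP/asboolP; apply: word_eq_sym.
- by move=> /asboolP uv /asboolP vw; apply/asboolP/(word_eq_trans uv vw).
Qed.

Canonical word_equiv := EquivRelPack word_eqb_equiv.

Definition pres_group : Type := {eq_quot word_eqb}.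

HB.instance Definition _ := Choice.on pres_group.
HB.instance Definition _ := EqQuotient.on pres_group.

Definition pres_pi (u : word) : pres_group := \pi_pres_group u.

Lemma pres_piP (u v : word) : pres_pi u = pres_pi v <-> word_eq u v.
Proof.
split=> [/eqmodP/asboolP//|uv].
exact/eqmodP/asboolP.
Qed.

Lemma pres_reprK (g : pres_group) : pres_pi (repr g) = g.
Proof. exact: reprK. Qed.

Lemma pres_repr_pi (u : word) : word_eq (repr (pres_pi u)) u.
Proof. by apply/pres_piP; rewrite pres_reprK. Qed.

Definition pres_one : pres_group := pres_pi [::].
Definition pres_mul (g h : pres_group) : pres_group :=
  pres_pi (repr g ++ repr h).
Definition pres_inv (g : pres_group) : pres_group :=
  pres_pi (inv_word (repr g)).

Lemma pres_mul_pi (u v : word) :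
  pres_mul (pres_pi u) (pres_pi v) = pres_pi (u ++ v).
Proof. by apply/pres_piP/word_eq_cat; apply: pres_repr_pi. Qed.

Lemma inv_letterK : involutive inv_letter.
Proof. by case=> i b; rewrite /inv_letter /= negbK. Qed.

Lemma inv_wordK : involutive inv_word.
Proof.
move=> u; rewrite /inv_word map_rev revK -map_comp.
by rewrite (eq_map (g := id)) ?map_id // => l; apply: inv_letterK.
Qed.

Lemma word_eq_mulV (u : word) : word_eq (u ++ inv_word u) [::].
Proof.
elim: u => [|l u IHu]; first exact: word_eq_refl.
rewrite /inv_word /= rev_cons -cats1 catA -/(inv_word u).
apply: word_eq_trans (word_eq_cancel l).
apply: (word_eq_cat (u := [:: l]) (u' := [:: l]) (word_eq_refl _)).
exact: (word_eq_cat (v := [:: inv_letter l]) (v' := [:: inv_letter l]) IHu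
          (word_eq_refl _)).
Qed.

Lemma word_eq_mulVl (u : word) : word_eq (inv_word u ++ u) [::].
Proof. by rewrite -[X in _ ++ X]inv_wordK; apply: word_eq_mulV. Qed.

Lemma pres_mulA : associative pres_mul.
Proof.
move=> g h k; rewrite -(pres_reprK g) -(pres_reprK h) -(pres_reprK k).
by rewrite !pres_mul_pi catA.
Qed.

Lemma pres_mul1g : left_id pres_one pres_mul.
Proof. by move=> g; rewrite -(pres_reprK g) pres_mul_pi. Qed.

Lemma pres_mulg1 : right_id pres_one pres_mul.
Proof. by move=> g; rewrite -(pres_reprK g) pres_mul_pi cats0. Qed.

Lemma pres_mulVg : left_inverse pres_one pres_inv pres_mul.
Proof.
move=> g; rewrite -[X in pres_mul _ X]pres_reprK pres_mul_pi.
exact/pres_piP/word_eq_mulVl.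
Qed.

Lemma pres_mulgV : right_inverse pres_one pres_inv pres_mul.
Proof.
move=> g; rewrite -[X in pres_mul X _]pres_reprK pres_mul_pi.
exact/pres_piP/word_eq_mulV.
Qed.

HB.instance Definition _ := isGroup.Build pres_group
  pres_mulA pres_mul1g pres_mulg1 pres_mulVg pres_mulgV.

Definition pres_gen (i : I) : pres_group := pres_pi [:: (i, false)].

End Presentation.

Local Open Scope group_scope.

Section WordMetric.
Variables (I : choiceType) (G : groupType) (x : I -> G).

Definition letter_val (l : letter I) : G := if l.2 then (x l.1)^-1 else x l.1.

Definition word_val (u : word I) : G := \prod_(l <- u) letter_val l.

Definition generates : Prop := forall g : G, exists u : word I, word_val u = g.

Lemma spelled_exists (x_gen : generates) (g : G) :
  exists n, `[< exists2 u : word I, size u = n & word_val u = g >].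
Proof. by have [u ug] := x_gen g; exists (size u); apply/asboolP; exists u. Qed.

Definition word_length (x_gen : generates) (g : G) : nat :=
  ex_minn (spelled_exists x_gen g).

Definition word_dist (x_gen : generates) (g h : G) : nat :=
  word_length x_gen (g^-1 * h).

Definition word_ball (x_gen : generates) (g : G) (k : nat) : set G :=
  [set h | (word_dist x_gen g h <= k)%N].

End WordMetric.

Lemma pres_gen_val (I : choiceType) (R : word I -> Prop) (u : word I) :
  word_val (@pres_gen I R) u = pres_pi R u.
Proof.
elim: u => [|[i b] u IHu]; rewrite /word_val ?big_nil // big_cons.
rewrite -[X in _ * X]/(word_val _ u) IHu.
have -> : letter_val (@pres_gen I R) (i, b) = pres_pi R [:: (i, b)].
  case: b => //=; apply: (mulgI (pres_gen R i)).
  rewrite mulgV; apply/esym; rewrite [LHS]pres_mul_pi.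
  exact/pres_piP/(word_eq_cancel R (i, false)).
by rewrite [LHS]pres_mul_pi.
Qed.

Lemma pres_gen_generates (I : choiceType) (R : word I -> Prop) :
  generates (@pres_gen I R).
Proof. by move=> g; exists (repr g); rewrite pres_gen_val pres_reprK. Qed.

(* Thompson's group F, with x_0 the generator false and x_1 the generator     *)
(* true.                                                                      *)
Definition X0 : word bool := [:: (false, false)].
Definition X1 : word bool := [:: (true, false)].

Definition thompson_relator (r : word bool) : Prop :=
  r = comm_word (X0 ++ inv_word X1) (inv_word X0 ++ X1 ++ X0) \/
  r = comm_word (X0 ++ inv_word X1)
        (inv_word X0 ++ inv_word X0 ++ X1 ++ X0 ++ X0).

Definition thompsonF : groupType := pres_group thompson_relator.

Definition F_length : thompsonF -> nat :=
  word_length (@pres_gen_generates bool thompson_relator).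

Definition F_ball : thompsonF -> nat -> set thompsonF :=
  word_ball (@pres_gen_generates bool thompson_relator).

Definition is_pocket (k : nat) (w : thompsonF) : Prop :=
  (0 < k)%N /\ (F_ball w k `<=` F_ball 1 (F_length w))%classic.

(* Main.v *)
Require Import Defs.
From mathcomp Require Import all_boot.
From mathcomp Require Import order ssralg ssrnum ssrint boolp zify.

Set Implicit Arguments.
Unset Strict Implicit.
Unset Printing Implicit Defensive.

(** We use the forest diagrams of Belk and Brown.  An element of F is a pair of
    forests with pointers; x_0 moves the top pointer one tree to the left and x_1
    cuts the current top tree into its two branches, so that F acts on diagrams.
    The action on the trivial diagram is free, because every element is a
    fraction p q^-1 of positive words and the diagram of a positive word
    x_0^a x_1^(e_1) ... x_m^(e_m) shows its exponents.  The length of an element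
    is, up to the constant 2, a sum of local costs of the leaves of its diagram:
    every generator changes this sum by one, and from every nontrivial diagram some generator lowers it.
    In every diagram one of x_1, x_1^-1, x_0^-1 x_1 x_1 leads to a larger length:
    x_1 if the current tree is a leaf, x_1^-1 if the current tree and its right
    neighbour are both nontrivial, and x_0^-1 x_1 x_1 otherwise. *)

(** * Binary trees with labelled leaves *)

(* A leaf of the bottom forest: the index of its tree relative to the bottom  *)
(* pointer and its address in that tree, last turn first (true is right).     *)
Definition label : Type := (int * seq bool)%type.

(* The left and right ends of a leaf are named so that the right end of a     *)
(* leaf is the left end of the next one, also after splitting or joining.     *)
Fixpoint strip0 (u : seq bool) : seq bool :=
  if u is false :: v then strip0 v else u.

Definition left_end (a : label) : label := (a.1, strip0 a.2).

Fixpoint right_end_rec (t : int) (u : seq bool) : label :=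
  match u with
  | [::] => ((t + 1)%R, [::])
  | true :: v => right_end_rec t v
  | false :: v => (t, true :: v)
  end.

Definition right_end (a : label) : label := right_end_rec a.1 a.2.

Inductive tree : Type := Leaf of label | Node of tree & tree.

Fixpoint first_leaf (T : tree) : label :=
  match T with Leaf a => a | Node A _ => first_leaf A end.

Fixpoint last_leaf (T : tree) : label :=
  match T with Leaf a => a | Node _ B => last_leaf B end.

Definition is_leaf (T : tree) : bool := if T is Leaf _ then true else false.

Definition is_leaf_at (a : label) (T : tree) : bool :=
  if T is Leaf b then b == a else false.

Definition split_tree (T : tree) : tree * tree :=
  match T with
  | Leaf a => (Leaf (a.1, false :: a.2), Leaf (a.1, true :: a.2))
  | Node A B => (A, B)
  end.

Definition siblings (A B : tree) : bool :=
  match A, B with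
  | Leaf (t, false :: u), Leaf b => b == (t, true :: u)
  | _, _ => false
  end.

(** A new top caret over the two halves of a bottom caret cancels with it, so diagrams stay
    reduced. *)
Definition join_tree (A B : tree) : tree :=
  if siblings A B then Leaf ((first_leaf A).1, behead (first_leaf A).2)
  else Node A B.

Fixpoint wf_tree (T : tree) : bool :=
  if T is Node A B then
    [&& wf_tree A, wf_tree B, ~~ siblings A B
      & right_end (last_leaf A) == left_end (first_leaf B)]
  else true.

Lemma is_leaf_atP a T : reflect (T = Leaf a) (is_leaf_at a T).
Proof.
case: T => [b|A B] /=; last by constructor.
by apply: (iffP eqP) => [->|[]].
Qed.

Lemma siblingsP A B :
  reflect (exists t u, A = Leaf (t, false :: u) /\ B = Leaf (t, true :: u))
          (siblings A B).
Proof.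
apply: (iffP idP) => [|[t [u [-> ->]]]]; last by rewrite /= eqxx.
case: A B => [[t [|[] u]]|A1 A2] [b|B1 B2] //= /eqP ->.
by exists t, u.
Qed.

Lemma join_treeK A B : split_tree (join_tree A B) = (A, B).
Proof. by rewrite /join_tree; case: siblingsP => [[t [u [-> ->]]]|]. Qed.

Lemma split_treeK T :
  wf_tree T -> join_tree (split_tree T).1 (split_tree T).2 = T.
Proof.
case: T => [[t u]|A B] /=; first by rewrite /join_tree /= eqxx.
by case/and4P => _ _ /negbTE sAB _; rewrite /join_tree sAB.
Qed.

Lemma wf_join A B : wf_tree A -> wf_tree B ->
  right_end (last_leaf A) = left_end (first_leaf B) ->
  [/\ wf_tree (join_tree A B),
      left_end (first_leaf (join_tree A B)) = left_end (first_leaf A)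
    & right_end (last_leaf (join_tree A B)) = right_end (last_leaf B)].
Proof.
move=> wA wB eAB; rewrite /join_tree; case: ifP => [|nsib]; last first.
  by split=> //=; rewrite wA wB nsib eAB eqxx.
by case/siblingsP => t [u [-> ->]].
Qed.

Lemma wf_split T A B : wf_tree T -> split_tree T = (A, B) ->
  [/\ wf_tree A, wf_tree B, left_end (first_leaf A) = left_end (first_leaf T),
      right_end (last_leaf A) = left_end (first_leaf B)
    & right_end (last_leaf B) = right_end (last_leaf T)].
Proof.
case: T => [[t u]|A' B'] /=; first by move=> _ [<- <-].
by case/and4P => wA wB _ /eqP e [<- <-].
Qed.

(** * The two sides of a forest *)

(* The trees on one side of the pointer, nearest first.  The integer n says   *)
(* that the list is followed by the leaves with indices n+1, n+2, ... (on the *)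
(* right, side true) or -n-1, -n-2, ... (on the left, side false).  A default  *)
(* leaf at the end of the list is trimmed unless its index is 0, the position *)
(* of the bottom pointer.                                                     *)
Definition side : Type := (seq tree * nat)%type.

Definition index (d : bool) (n : nat) : int :=
  if d then Posz n else (- Posz n)%R.
Definition default (d : bool) (n : nat) : tree := Leaf (index d n, [::]).

Definition near (d : bool) (T : tree) : label :=
  if d then left_end (first_leaf T) else right_end (last_leaf T).
Definition far (d : bool) (T : tree) : label := near (~~ d) T.

Definition trims (d : bool) (T : tree) (s : side) : bool :=
  [&& nilp s.1, 0 < s.2 & is_leaf_at (index d s.2, [::]) T].

Definition push (d : bool) (T : tree) (s : side) : side :=
  if trims d T s then ([::], s.2.-1) else (T :: s.1, s.2).

Definition pop (d : bool) (s : side) : tree * side :=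
  if s.1 is T :: Ts then (T, (Ts, s.2))
  else (default d s.2.+1, ([::], s.2.+1)).

(** [q] is the end that the next tree outwards must share, so the trees follow each other without
    gaps, up to the default leaves. *)
Fixpoint chain (d : bool) (q : label) (Ts : seq tree) (n : nat) : bool :=
  if Ts is T :: Ts' then
    [&& wf_tree T, near d T == q, ~~ trims d T (Ts', n)
      & chain d (far d T) Ts' n]
  else q == far d (default d n).

Definition wf_side (d : bool) (q : label) (s : side) : bool :=
  chain d q s.1 s.2.

Lemma trimsP d T s :
  reflect (exists n, T = default d n.+1 /\ s = ([::], n.+1)) (trims d T s).
Proof.
apply: (iffP and3P) => [[]|[n [-> ->]]]; last by rewrite /= eqxx.
case: s => [[|//] [|n]] //= _ _ /is_leaf_atP ->.
by exists n.
Qed.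

Lemma pushK d T s : pop d (push d T s) = (T, s).
Proof.
rewrite /push; case: trimsP => [[n [-> ->]]|_] //=.
by case: s.
Qed.

Lemma popK d q s : wf_side d q s -> push d (pop d s).1 (pop d s).2 = s.
Proof.
case: s => [[|T Ts] n]; rewrite /wf_side /push /= => h.
  by rewrite /trims /= eqxx.
by case/and4P: h => _ _ /negbTE ->.
Qed.

Lemma near_default d n : near d (default d n.+1) = far d (default d n).
Proof.
by case: d; rewrite /near /far /= /left_end /right_end /=; congr (_, _); lia.
Qed.

Lemma wf_push d T s :
  wf_tree T -> wf_side d (far d T) s -> wf_side d (near d T) (push d T s).
Proof.
move=> wT; rewrite /push; case: trimsP => [[n [-> ->]] _|].
  by rewrite /wf_side /= near_default.
case: s => Ts n /trimsP h ws; rewrite /wf_side /= wT eqxx h; exact: ws.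
Qed.

Lemma wf_pop d q s : wf_side d q s ->
  [/\ wf_tree (pop d s).1, near d (pop d s).1 = q
    & wf_side d (far d (pop d s).1) (pop d s).2].
Proof.
case: s => [[|T Ts] n]; rewrite /wf_side /=.
  by move=> /eqP ->; split=> //; rewrite near_default.
by case/and4P => ? /eqP ? _ ?; split.
Qed.

Lemma trims_pop d q s : wf_side d q s ->
  trims d (pop d s).1 (pop d s).2 = nilp s.1.
Proof.
case: s => [[|T Ts] n]; rewrite /wf_side /=; first by rewrite /trims /= eqxx.
by case/and4P => _ _ /negbTE ->.
Qed.

Lemma nilp_push d T s : nilp (push d T s).1 = trims d T s.
Proof. by rewrite /push; case: ifP. Qed.

(** * Forest diagrams and the action of the generators *)

(* A forest diagram: the top tree under the pointer, between its left and     *)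
(* right neighbours; the bottom forest is recorded in the leaf labels.        *)
Definition state : Type := (side * tree * side)%type.

Definition wf_state (s : state) : bool :=
  let: (l, c, r) := s in
  [&& wf_tree c, wf_side false (near true c) l & wf_side true (near false c) r].

Definition origin : state := (([::], 0), Leaf (0%R, [::]), ([::], 0)).

Definition move_left (s : state) : state :=
  let: (l, c, r) := s in ((pop false l).2, (pop false l).1, push true c r).
Definition move_right (s : state) : state :=
  let: (l, c, r) := s in (push false c l, (pop true r).1, (pop true r).2).
Definition cut (s : state) : state :=
  let: (l, c, r) := s in
  (l, (split_tree c).1, push true (split_tree c).2 r).
Definition glue (s : state) : state :=
  let: (l, c, r) := s in (l, join_tree c (pop true r).1, (pop true r).2).

Lemma wf_origin : wf_state origin.
Proof. by []. Qed.

Lemma wf_move_left s : wf_state s -> wf_state (move_left s).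
Proof.
case: s => [[l c] r] /and3P[wc wl wr]; have [wp np wl'] := wf_pop wl.
by apply/and3P; split=> //; rewrite np; apply: wf_push.
Qed.

Lemma wf_move_right s : wf_state s -> wf_state (move_right s).
Proof.
case: s => [[l c] r] /and3P[wc wl wr]; have [wp np wr'] := wf_pop wr.
apply/and3P; split=> //; rewrite [near true _]np.
by apply: (wf_push (d := false)).
Qed.

Lemma wf_cut s : wf_state s -> wf_state (cut s).
Proof.
case: s => [[l c] r] /and3P[wc wl wr]; rewrite /cut.
case e: (split_tree c) => [A B]; have [wA wB eA eAB eB] := wf_split wc e.
apply/and3P; split=> //; first by rewrite /near /= eA.
rewrite [near false _]eAB; apply: (wf_push (d := true)) => //.
by rewrite /far /near /= eB.
Qed.

Lemma wf_glue s : wf_state s -> wf_state (glue s).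
Proof.
case: s => [[l c] r] /and3P[wc wl wr]; have [wd nd wr'] := wf_pop wr.
have [wj ej1 ej2] := wf_join wc wd (esym nd).
by apply/and3P; split=> //; rewrite /near /= ?ej1 ?ej2.
Qed.

Lemma move_leftK s : wf_state s -> move_right (move_left s) = s.
Proof.
by case: s => [[l c] r] /and3P[wc wl wr] /=; rewrite pushK /= (popK wl).
Qed.

Lemma move_rightK s : wf_state s -> move_left (move_right s) = s.
Proof.
by case: s => [[l c] r] /and3P[wc wl wr] /=; rewrite pushK /= (popK wr).
Qed.

Lemma cutK s : wf_state s -> glue (cut s) = s.
Proof.
by case: s => [[l c] r] /and3P[wc wl wr] /=; rewrite pushK /= (split_treeK wc).
Qed.

Lemma glueK s : wf_state s -> cut (glue s) = s.
Proof.
case: s => [[l c] r] /and3P[wc wl wr] /=.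
by rewrite join_treeK /= (popK wr).
Qed.

Definition act (s : state) (x : letter bool) : state :=
  match x with
  | (false, false) => move_left s
  | (false, true) => move_right s
  | (true, false) => cut s
  | (true, true) => glue s
  end.

Definition act_word (s : state) (u : word bool) : state := foldl act s u.

Lemma wf_act s x : wf_state s -> wf_state (act s x).
Proof.
by case: x => [[] []]; [exact: wf_glue|exact: wf_cut|exact: wf_move_right|
  exact: wf_move_left].
Qed.

Lemma wf_act_word s u : wf_state s -> wf_state (act_word s u).
Proof. by elim: u s => //= x u IHu s ws; apply/IHu/wf_act. Qed.

Lemma act_cancel s x : wf_state s -> act (act s x) (inv_letter x) = s.
Proof.
by case: x => [[] []] ws /=; rewrite ?glueK ?cutK ?move_leftK ?move_rightK.
Qed.

Lemma act_word_cat s u v : act_word s (u ++ v) = act_word (act_word s u) v.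
Proof. exact: foldl_cat. Qed.

Lemma act_word_cancel s u :
  wf_state s -> act_word (act_word s u) (inv_word u) = s.
Proof.
elim: u s => // x u IHu s ws; rewrite /inv_word map_cons rev_cons -cats1.
rewrite act_word_cat -[act_word s (x :: u)]/(act_word (act s x) u).
by rewrite IHu ?wf_act //; apply: act_cancel.
Qed.

Lemma act_word_cancelV s u :
  wf_state s -> act_word (act_word s (inv_word u)) u = s.
Proof. by move=> ws; rewrite -{2}(inv_wordK u) act_word_cancel. Qed.

Lemma act_comm_word u v :
  (forall s, act_word s (u ++ v) = act_word s (v ++ u)) ->
  forall s, wf_state s -> act_word s (comm_word u v) = s.
Proof.
move=> uvC s ws; rewrite /comm_word catA act_word_cat uvC !act_word_cat.
by rewrite !act_word_cancelV ?wf_act_word.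
Qed.

(** The first word joins the current tree to its left neighbour, the second cuts the first or second
    tree to the right. They touch disjoint trees, hence commute. *)
Lemma act_relator r s :
  thompson_relator r -> wf_state s -> act_word s r = s.
Proof.
move=> [] -> {r}; apply: act_comm_word => {s} -[[l c] r] /=;
  by rewrite ?pushK /= ?pushK /= ?pushK /= ?pushK.
Qed.

Lemma act_word_eq u v s :
  word_eq thompson_relator u v -> wf_state s -> act_word s u = act_word s v.
Proof.
move=> uv; elim: uv s => {u v} //=.
- by move=> u v _ IH s ws; rewrite IH.
- by move=> u v w _ IH1 _ IH2 s ws; rewrite IH1 // IH2.
- move=> u u' v v' _ IH1 _ IH2 s ws.
  by rewrite !act_word_cat IH1 // IH2 // wf_act_word.
- by move=> x s ws; apply: act_cancel.
- by move=> r rr s; apply: act_relator.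
Qed.

(** * The cost of a diagram and its change under the generators *)

(* The labels L, N, R, I of Belk and Brown for the space immediately to the   *)
(* left of a leaf, first in the bottom forest, then their table of weights    *)
(* (top label first).                                                         *)
Inductive kind : Type := KL | KN | KR | KI.

Definition exterior_left (a : label) : bool :=
  (strip0 a.2 == [::]) && (a.1 <= 0)%R.

Definition kind_of (a : label) : kind :=
  if exterior_left a then KL else
  match a.2 with [::] => KR | false :: _ => KN | true :: _ => KI end.

Definition table (top bottom : kind) : nat :=
  match top, bottom with
  | KL, KL => 2 | KL, _ => 1
  | _, KL => 1
  | KN, _ => 2 | _, KN => 2
  | KR, KR => 2
  | _, _ => 0
  end.

(* A bottom caret is charged to the leftmost leaf of its right branch.        *)
Definition leaf_cost (k : kind) (a : label) : nat :=
  table k (kind_of a) + (strip0 a.2 != [::]).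

Fixpoint inner_cost (T : tree) : nat :=
  if T is Node A B then
    (inner_cost A + inner_cost B
     + leaf_cost (if is_leaf B then KI else KN) (first_leaf B)).+1
  else 0.

Definition tree_cost (d : bool) (T : tree) : nat :=
  inner_cost T
  + leaf_cost (if d then if is_leaf T then KR else KN else KL) (first_leaf T).

Definition side_cost (d : bool) (s : side) : nat :=
  sumn (map (tree_cost d) s.1).

Definition cost (s : state) : nat :=
  let: (l, c, r) := s in
  side_cost false l + tree_cost false c + side_cost true r.

Lemma cost_origin : cost origin = 2.
Proof. by []. Qed.

Lemma default_cost d n : tree_cost d (default d n.+1) = 2.
Proof. by case: d; case: n. Qed.

Lemma push_cost d T s :
  side_cost d (push d T s) + (trims d T s).*2 = side_cost d s + tree_cost d T.
Proof.
rewrite /push; case: trimsP => [[n [-> ->]]|_] /=.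
  by rewrite default_cost.
by rewrite /side_cost /=; lia.
Qed.

Lemma pop_cost d s :
  side_cost d (pop d s).2 + tree_cost d (pop d s).1
  = side_cost d s + (nilp s.1).*2.
Proof.
case: s => [[|T Ts] n] /=; first by rewrite default_cost.
by rewrite /side_cost /=; lia.
Qed.

(** These trees get cheaper by one when they pass from under the pointer to its right; all others
    get dearer by one. *)
Definition sinks (T : tree) : bool :=
  match kind_of (first_leaf T) with
  | KL => true | KI => is_leaf T | _ => false
  end.

Lemma tree_cost_sinks T :
  if sinks T then (tree_cost true T).+1 = tree_cost false T
  else tree_cost true T = (tree_cost false T).+1.
Proof.
rewrite /tree_cost /sinks /leaf_cost.
by case: (kind_of _); case: (is_leaf T) => /=; lia.
Qed.

(** Besides the change of one for [c], opening a default leaf on the left adds 2 and trimming one on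
    the right removes 2. *)
Definition left_lowers (s : state) : bool :=
  let: (l, c, r) := s in if sinks c then ~~ nilp l.1 else trims true c r.

Lemma wf_sinks l c r : wf_state (l, c, r) -> nilp l.1 -> sinks c.
Proof.
case: l => [[|//] n] /and3P[_ /eqP e _] _.
suff h: exterior_left (first_leaf c) by rewrite /sinks /kind_of h.
move: e; rewrite /far /near /= /left_end /exterior_left => -[-> ->] /=.
by lia.
Qed.

Lemma trims_sinks c r : trims true c r -> ~~ sinks c.
Proof. by case/trimsP => n [-> _]. Qed.

Lemma cost_move_left s : wf_state s ->
  if left_lowers s then (cost (move_left s)).+1 = cost s
  else cost (move_left s) = (cost s).+1.
Proof.
case: s => [[l c] r] ws /=.
have := push_cost true c r; have := pop_cost false l.
have := tree_cost_sinks c; have := wf_sinks ws; have := @trims_sinks c r.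
by case: (sinks c); case: (nilp l.1); case: (trims true c r) => /=; lia.
Qed.

(** Cutting saves the caret. A leaf [B] changes its top label from [KI] to [KR], which costs 2 more
    exactly over the bottom label [KR], unless [B] is trimmed. *)
Definition cut_lowers (s : state) : bool :=
  let: (l, c, r) := s in
  if c is Node A B then
    ~~ (is_leaf B && (if kind_of (first_leaf B) is KR then true else false))
    || trims true B r
  else false.

Lemma cost_cut s : wf_state s ->
  if cut_lowers s then (cost (cut s)).+1 = cost s
  else cost (cut s) = (cost s).+1.
Proof.
case: s => [[l [[t u]|A B]] r] ws /=.
  have tr : trims true (Leaf (t, true :: u)) r = false.
    by apply/negbTE/trimsP => -[n []].
  have := push_cost true (Leaf (t, true :: u)) r; rewrite tr /=.
  rewrite /tree_cost /leaf_cost /kind_of /exterior_left /=.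
  by case: (strip0 u == [::]); case: u {tr ws} => [|[] u] /=;
    case: (t <= 0)%R => /=; lia.
have := push_cost true B r; rewrite /tree_cost.
case: (trimsP true B r) => [[n [-> ->]]|_] /=.
  by rewrite /leaf_cost /=; lia.
rewrite /leaf_cost.
by case: (kind_of (first_leaf B)); case: (is_leaf B) => /=; lia.
Qed.

Lemma cost_move_right s : wf_state s ->
  if left_lowers (move_right s) then cost (move_right s) = (cost s).+1
  else (cost (move_right s)).+1 = cost s.
Proof.
move=> ws; have := cost_move_left (wf_move_right ws); rewrite move_rightK //.
by case: ifP.
Qed.

Lemma cost_glue s : wf_state s ->
  if cut_lowers (glue s) then cost (glue s) = (cost s).+1
  else (cost (glue s)).+1 = cost s.
Proof.
move=> ws; have := cost_cut (wf_glue ws); rewrite glueK //.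
by case: ifP.
Qed.

Lemma cost_act s x : wf_state s ->
  cost s <= (cost (act s x)).+1 /\ cost (act s x) <= (cost s).+1.
Proof.
move=> ws; case: x => [[] []] /=.
- by have := cost_glue ws; case: ifP => _; lia.
- by have := cost_cut ws; case: ifP => _; lia.
- by have := cost_move_right ws; case: ifP => _; lia.
- by have := cost_move_left ws; case: ifP => _; lia.
Qed.

(** * Lowering and raising the cost *)

(** Without the label [KL] only a leaf of kind [KI] sinks; its last turn is to the right, so its
    address is its own left end. *)
Lemma sinks_interior T t u : sinks T -> left_end (first_leaf T) = (t, u) ->
  ~~ ((u == [::]) && (t <= 0)%R) -> exists2 v, T = Leaf (t, u) & u = true :: v.
Proof.
move=> + e h; rewrite /sinks /kind_of ifN; last first.
  by move: e; rewrite /exterior_left /left_end => -[-> ->].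
case: T e => [[t' [|[] v]]|A B] //=; first by move=> [<- <-] _; exists v.
by case: (first_leaf A).2 => [|[] ?].
Qed.

Lemma left_lowers_right l c r : wf_state (l, c, r) ->
  left_lowers (move_right (l, c, r)) =
  if sinks (pop true r).1 then ~~ trims false c l else nilp r.1.
Proof.
by case/and3P => _ _ wr; rewrite /= nilp_push (trims_pop wr).
Qed.

Lemma near_pop l c r : wf_state (l, c, r) ->
  left_end (first_leaf (pop true r).1) = right_end (last_leaf c).
Proof. by case/and3P => _ _ /wf_pop[]. Qed.

Lemma nil_right l c r : wf_state (l, c, r) -> nilp r.1 ->
  right_end (last_leaf c) = ((Posz r.2 + 1)%R, [::]).
Proof. by case: r => [[|//] n] /and3P[_ _ /eqP]. Qed.

Lemma nil_left l c r : wf_state (l, c, r) -> nilp l.1 ->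
  left_end (first_leaf c) = ((- Posz l.2)%R, [::]).
Proof. by case: l => [[|//] n] /and3P[_ /eqP]. Qed.

Definition descends (s : state) : Prop :=
  exists x, (cost (act s x)).+1 = cost s.

Lemma descends_left s : wf_state s -> left_lowers s -> descends s.
Proof.
by move=> ws h; exists (false, false); have := cost_move_left ws; rewrite h.
Qed.

Lemma descends_right s :
  wf_state s -> ~~ left_lowers (move_right s) -> descends s.
Proof.
move=> ws /negbTE h; exists (false, true).
by have := cost_move_right ws; rewrite h.
Qed.

Lemma descends_cut s : wf_state s -> cut_lowers s -> descends s.
Proof.
by move=> ws h; exists (true, false); have := cost_cut ws; rewrite h.
Qed.

Lemma descends_glue s : wf_state s -> ~~ cut_lowers (glue s) -> descends s.
Proof.
move=> ws /negbTE h; exists (true, true).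
by have := cost_glue ws; rewrite h.
Qed.

Lemma descends_node l A B r :
  wf_state (l, Node A B, r) -> descends (l, Node A B, r).
Proof.
move=> ws; have [/descends_cut|] := boolP (cut_lowers (l, Node A B, r)).
  by apply.
rewrite /= negb_or negbK => /andP[].
case: B ws => [[t [|b u]]|//] ws; last first.
  by rewrite /kind_of /=; case: ifP => //; case: b {ws}.
(* Only a leaf [B] of kind [KR] remains. The next tree starts at index [t + 1 > 0], so it does not
   sink. *)
rewrite /kind_of /exterior_left /= => tR ntr; apply: descends_right => //.
have {tR} t_gt0 : (0 < t)%R by move: tR; case: ifP => //; lia.
rewrite left_lowers_right //; case: ifP => [sd|_].
  by have [|] := sinks_interior sd (near_pop ws); first by rewrite /=; lia.
(* An empty right side would have the index [t], and then cutting would trim [B]. *)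
apply: contra ntr => r0; have [] := nil_right ws r0.
case: r r0 {ws} => [[|//] n] _ /= e.
by have -> : t = Posz n by [lia]; rewrite /trims /= eqxx; lia.
Qed.

(** If the right neighbour sinks, it is the sibling leaf and gluing cancels a bottom caret;
    otherwise moving right lowers the cost. *)
Lemma descends_zero l t u r :
  wf_state (l, Leaf (t, false :: u), r) ->
  descends (l, Leaf (t, false :: u), r).
Proof.
move=> ws; have e : left_end _ = (t, true :: u) := near_pop ws.
have [sd|nsd] := boolP (sinks (pop true r).1); last first.
  apply: descends_right; rewrite // left_lowers_right // (negbTE nsd).
  by apply/negP => /(nil_right ws).
have [//|v ed _] := sinks_interior sd e.
by apply: descends_glue; rewrite //= ed /join_tree /= eqxx.
Qed.

Lemma descends_leaf l t u r :
  wf_state (l, Leaf (t, u), r) -> (l, Leaf (t, u), r) <> origin ->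
  descends (l, Leaf (t, u), r).
Proof.
case: u => [|[] u] ws; last by move=> _; apply: descends_zero.
  have := nil_right ws; have := nil_left ws; have := near_pop ws => /=.
  rewrite /left_end /right_end /= => e el er ns.
  have [/descends_left|] := boolP (left_lowers (l, Leaf (t, [::]), r)).
    exact.
  rewrite /= /sinks /kind_of /exterior_left /=.
  have [t_le0|t_gt0] := boolP (t <= 0)%R => /=.
    rewrite negbK => l0; have [et] := el l0.
    apply: descends_right; rewrite // left_lowers_right //; case: ifP => [sd|_].
      rewrite negbK; case: l l0 et {ws el ns} => [[|//] [|n]] _ /= et.
        (* Here the current leaf has index 0, so the next tree starts at index 1 and cannot sink. *)
        by have [|] := sinks_interior sd e; first by rewrite /=; lia.
      by rewrite et /trims /= eqxx.
    (* With both sides empty, [t] is at once nonpositive and nonnegative, which forces [origin]. *)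
    apply/negP => r0; have [et'] := er r0; case: ns.
    case: l r l0 r0 et et' {e el er ws} => [[|//] n] [[|//] m] _ _ /= et et'.
    have [-> -> ->] // : [/\ t = Posz 0, n = 0 & m = 0] by split; lia.
  move=> ntr; apply: descends_right; rewrite // left_lowers_right //.
  case: ifP => [sd|_].
    by have [|] := sinks_interior sd e; first by rewrite /=; lia.
  apply: contra ntr => r0; have [] := er r0.
  case: r r0 {ws e er ns} => [[|//] n] _ /= et.
  by have -> : t = Posz n by [lia]; rewrite /trims /= eqxx; lia.
move=> _; apply: descends_left; rewrite //=.
by apply/negP => /(nil_left ws).
Qed.

Lemma descent s : wf_state s -> s <> origin -> descends s.
Proof.
by case: s => [[l [[t u]|A B]] r]; [apply: descends_leaf|
  move=> ws _; apply: descends_node].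
Qed.

(* If cutting or gluing does not raise the cost, the right neighbour is a     *)
(* leaf, and cutting a leaf twice makes up for the move to it.                *)
Lemma ascent s : wf_state s ->
  exists2 u, size u <= 3 & cost s < cost (act_word s u).
Proof.
case: s => [[l [a|A B]] r] ws.
  exists [:: (true, false)] => //=.
  by have := cost_cut ws; rewrite /= => ->.
have [sl|nl] := boolP (is_leaf (pop true r).1); last first.
  exists [:: (true, true)] => //.
  by have := cost_glue ws; rewrite /= /join_tree /= (negbTE nl) /= => ->.
set s := (l, _, r) in ws *.
exists [:: (false, true); (true, false); (true, false)] => //.
have w1 := wf_move_right ws; have w2 := wf_cut w1.
have h1 : cost s <= (cost (move_right s)).+1 := (cost_act (false, true) ws).1.
have h2 : cost (cut (move_right s)) = (cost (move_right s)).+1.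
  by have := cost_cut w1; rewrite /=; case: (pop true r).1 sl.
have h3 : cost (cut (cut (move_right s))) = (cost (cut (move_right s))).+1.
  by have := cost_cut w2; rewrite /=; case: (pop true r).1 sl.
by rewrite -[act_word s _]/(cut (cut (move_right s))) h3 h2; lia.
Qed.

Local Open Scope group_scope.

(** * Normal forms of positive words, and fractions *)

Section PositiveMonoid.

Variables (G : groupType) (x : bool -> G).

Local Notation x0 := (x false).
Local Notation x1 := (x true).

Definition xgen (i : nat) : G := if i is n.+1 then x1 ^ (x0 ^+ n) else x0.

Definition positive (js : seq nat) : G := \prod_(j <- js) xgen j.

(** On diagrams each entry [e] means [e] cuts followed by one move to the right. *)
Fixpoint tower (es : seq nat) : G :=
  if es is e :: es' then x1 ^+ e * x0^-1 * tower es' else 1.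

(* For e_1, ..., e_m this is x_0^a x_1^(e_1) ... x_m^(e_m).                   *)
Definition normal_form (a : nat) (es : seq nat) : G :=
  x0 ^+ a * tower es * x0 ^+ size es.

Hypothesis comm1 : commute (x0 * x1^-1) (x1 ^ x0).
Hypothesis comm2 : commute (x0 * x1^-1) (x1 ^ (x0 ^+ 2)).

Lemma xgen_conj_x0 n : xgen n.+1 ^ x0 = xgen n.+2.
Proof. by rewrite /= expgSr conjgM. Qed.

Lemma xgen_conj_exp n k : xgen n.+1 ^ (x0 ^+ k) = xgen (n + k).+1.
Proof. by rewrite /= expgnDr conjgM. Qed.

Lemma commute_conj y : commute (x0 * x1^-1) y -> y ^ x1 = y ^ x0.
Proof.
move=> /esym yC; apply: (conjg_inj x1^-1); rewrite -!conjgM mulgV conjg1.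
by rewrite conjgE yC mulKg.
Qed.

(** The two relations are the cases 0 and 1. Beyond them, writing x_i for [xgen i], conjugating
    x_(n+4) = x_(n+3)^(x_2) by x_1 gives x_(n+4)^(x_3), and this is x_(n+5) by an earlier case
    conjugated by x_0^2. *)
Lemma xgen_conj_x1 n : xgen n.+2 ^ x1 = xgen n.+3.
Proof.
elim/ltn_ind: n => -[|[|n]] IHn.
- by rewrite -[RHS]xgen_conj_x0; apply: commute_conj; rewrite /= expg1.
- by rewrite -[RHS]xgen_conj_x0; apply: commute_conj.
have e k : xgen (n + k).+2 ^ xgen k.+1 = xgen (n + k).+3.
  have := congr1 (conjg^~ (x0 ^+ k)) (IHn n (ltnW (ltnSn _))).
  by rewrite /= conjJg !xgen_conj_exp.
have := e 1%N; have := e 2; rewrite addn1 addn2 => e2 e1.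
by rewrite -[xgen n.+4]e1 conjJg !IHn.
Qed.

Lemma xgen_conj i j : i < j -> xgen j ^ xgen i = xgen j.+1.
Proof.
case: i j => [|i] [|j] // ij; first exact: xgen_conj_x0.
have -> : j = ((j - i.+1).+1 + i)%N by rewrite subnSK ?subnK // ltnW.
rewrite -[RHS](xgen_conj_exp (j - i.+1).+2) -xgen_conj_x1 [RHS]conjJg.
by rewrite xgen_conj_exp.
Qed.

Lemma xgen_mul i j : i < j -> xgen j * xgen i = xgen i * xgen j.+1.
Proof. by move=> ij; rewrite -(xgen_conj ij) -conjgC. Qed.

Lemma xgen_mul_exp n e : xgen n.+2 * x1 ^+ e = x1 ^+ e * xgen (n + e).+2.
Proof.
elim: e n => [|e IHe] n; first by rewrite addn0 mulg1 mul1g.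
rewrite expgS mulgA [_ * x1]conjgC xgen_conj_x1.
by rewrite -[LHS]mulgA IHe mulgA addSnnS.
Qed.

(** The generator moves right: passing [x1 ^+ e] raises its index by [e], passing [x0^-1] lowers it
    by one, until it is absorbed as a factor [x1]. Beyond the end of the tower, zero exponents are
    added. *)
Lemma tower_insert k es : exists es',
  xgen k.+1 * (tower es * x0 ^+ size es) = tower es' * x0 ^+ size es'.
Proof.
have cons_tower e fs :
    tower (e :: fs) * x0 ^+ size (e :: fs)
    = x1 ^+ e * (x0^-1 * (tower fs * x0 ^+ size fs)) * x0.
  by rewrite /= expgSr !mulgA.
elim: es k => [|e es IHes] k.
  elim: k => [|k [es' IHk]].
    by exists [:: 1%N]; rewrite /= conjg1 !mulg1 expg1 mulgVK.
  exists (0%N :: es'); rewrite cons_tower -IHk /= !mulg1 mul1g.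
  by rewrite expgSr conjgM; apply: mulgA.
case: k => [|k].
  by exists (e.+1 :: es); rewrite /= conjg1 (expgS x1) !mulgA.
have [es' IH] := IHes (k + e)%N; exists (e :: es').
rewrite !cons_tower -IH; have := xgen_mul_exp k e; have := xgen_conj_x0 (k + e).
move: (xgen _) (xgen _) (xgen _) (x1 ^+ e) (tower es * _) => y y' z b t <-.
by rewrite conjgE => zb; rewrite !mulgA zb !mulgA mulgK.
Qed.

Lemma xgen_normal_form i a es : exists a' es',
  xgen i * normal_form a es = normal_form a' es'.
Proof.
case: i => [|i]; first by exists a.+1, es; rewrite /normal_form expgS !mulgA.
have [es' e] := tower_insert (i + a) es; exists a, es'.
rewrite /normal_form -[RHS]mulgA -e.
have := conjgC (xgen i.+1) (x0 ^+ a); rewrite xgen_conj_exp.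
by move: (xgen _) (xgen _) (x0 ^+ a) => y z b yb; rewrite !mulgA yb.
Qed.

Lemma positive_normal_form js : exists a es, positive js = normal_form a es.
Proof.
rewrite /positive; elim: js => [|j js [a [es IHjs]]].
  by exists 0%N, [::]; rewrite big_nil /normal_form !mulg1.
by rewrite big_cons IHjs; apply: xgen_normal_form.
Qed.

Lemma tower_pad es k : tower (es ++ nseq k 0%N) = tower es * x0 ^- k.
Proof.
elim: es => [|e es IHes] /=; last by rewrite IHes !mulgA.
elim: k => [|k IHk] /=; first by rewrite invg1 mulg1.
by rewrite IHk !mul1g expgSr invgM.
Qed.

Lemma normal_form_pad a es k :
  normal_form a (es ++ nseq k 0%N) = normal_form a es.
Proof.
rewrite /normal_form tower_pad size_cat size_nseq addnC expgnDr !mulgA.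
by rewrite mulgVK.
Qed.

Lemma fraction_mul_xgen js i : exists ps js',
  (positive js)^-1 * xgen i = positive ps * (positive js')^-1.
Proof.
rewrite /positive; elim: js i => [|j js IHjs] i.
  by exists [:: i], [::]; rewrite big_seq1 big_nil invg1 mul1g mulg1.
have step m n : (xgen j)^-1 * xgen i = xgen m * (xgen n)^-1 ->
    exists ps js', (positive (j :: js))^-1 * xgen i
                    = positive ps * (positive js')^-1.
  move=> e; have [ps [js' IH]] := IHjs m; exists ps, (n :: js').
  by rewrite /positive !big_cons !invgM -mulgA e !mulgA IH.
case: (ltngtP i j) => [ij|ji|<-].
- apply: (step i j.+1); apply: (mulIg (xgen j.+1)).
  by rewrite mulgVK -mulgA -(xgen_mul ij) mulKg.
- apply: (step i.+1 j); apply: (mulIg (xgen j)).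
  by rewrite mulgVK -mulgA (xgen_mul ji) mulKg.
by exists [::], js; rewrite !big_cons big_nil mul1g invgM mulgVK.
Qed.

Lemma fraction (u : word bool) :
  exists ps js, word_val x u = positive ps * (positive js)^-1.
Proof.
elim/last_ind: u => [|u [b inv] [ps [js IHu]]].
  by exists [::], [::]; rewrite /word_val /positive !big_nil invg1 mulg1.
have xb : x b = xgen b by case: b; rewrite //= conjg1.
rewrite /word_val big_rcons -/(word_val x u) IHu /letter_val /= xb.
case: inv; last first.
  have [ps2 [js2 e]] := fraction_mul_xgen js b; exists (ps ++ ps2), js2.
  by rewrite -mulgA e mulgA /positive big_cat.
by exists ps, (nat_of_bool b :: js); rewrite /positive big_cons invgM mulgA.
Qed.

Lemma normal_fraction (u : word bool) : exists a es b fs,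
  size es = size fs /\ word_val x u = normal_form a es * (normal_form b fs)^-1.
Proof.
have [ps [js ->]] := fraction u.
have [a [es ->]] := positive_normal_form ps.
have [b [fs ->]] := positive_normal_form js.
(* Padding with zero exponents makes the two towers comparable entry by entry. *)
exists a, (es ++ nseq (size fs) 0%N), b, (fs ++ nseq (size es) 0%N).
by rewrite !normal_form_pad !size_cat !size_nseq addnC.
Qed.

End PositiveMonoid.

(** * The action of F and its freeness at [origin] *)

Local Notation pi := (pres_pi thompson_relator).
Local Notation gen := (pres_gen thompson_relator).

Lemma pi_cat u v : pi (u ++ v) = pi u * pi v :> thompsonF.
Proof. by rewrite -pres_mul_pi. Qed.

Lemma pi_inv u : pi (inv_word u) = (pi u)^-1 :> thompsonF.
Proof.
apply/esym/mulg1_eq; rewrite -pi_cat.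
exact/pres_piP/word_eq_mulV.
Qed.

Lemma pi_comm_word u v :
  thompson_relator (comm_word u v) -> commute (pi u : thompsonF) (pi v).
Proof.
move=> ruv; apply/commgP/eqP.
have <- : pi (comm_word u v) = [~ pi u, pi v].
  by rewrite /comm_word !pi_cat !pi_inv.
exact/pres_piP/word_eq_rel.
Qed.

Lemma thompson_comm1 :
  commute (gen false * (gen true)^-1 : thompsonF) (gen true ^ gen false).
Proof.
have := @pi_comm_word (X0 ++ inv_word X1) (inv_word X0 ++ X1 ++ X0).
by rewrite !pi_cat !pi_inv; apply; left.
Qed.

Lemma thompson_comm2 :
  commute (gen false * (gen true)^-1 : thompsonF) (gen true ^ (gen false ^+ 2)).
Proof.
have := @pi_comm_word (X0 ++ inv_word X1)
  (inv_word X0 ++ inv_word X0 ++ X1 ++ X0 ++ X0).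
by rewrite !pi_cat !pi_inv expg2 conjgM !conjgE !mulgA; apply; right.
Qed.

Definition actF (s : state) (g : thompsonF) : state := act_word s (repr g).

Lemma actF_pi s u : wf_state s -> actF s (pi u) = act_word s u.
Proof. exact/act_word_eq/pres_repr_pi. Qed.

Lemma wf_actF s g : wf_state s -> wf_state (actF s g).
Proof. exact: wf_act_word. Qed.

Lemma actFM s g h : wf_state s -> actF s (g * h) = actF (actF s g) h.
Proof. by move=> ws; rewrite [g * h]/(pi _) actF_pi // act_word_cat. Qed.

Lemma actF1 s : wf_state s -> actF s 1 = s.
Proof. by move=> ws; rewrite [1]/(pi [::]) actF_pi. Qed.

Lemma actFK s g : wf_state s -> actF (actF s g) g^-1 = s.
Proof. by move=> ws; rewrite -actFM // mulgV actF1. Qed.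

Lemma actF_gen0 s : wf_state s -> actF s (gen false) = move_left s.
Proof. exact: actF_pi. Qed.

Lemma actF_gen1 s : wf_state s -> actF s (gen true) = cut s.
Proof. exact: actF_pi. Qed.

Lemma actF_gen0V s : wf_state s -> actF s (gen false)^-1 = move_right s.
Proof. by move=> ws; rewrite -pi_inv actF_pi. Qed.

Lemma actF_cut_left s e : wf_state s ->
  (actF s (gen true ^+ e)).1.1 = s.1.1.
Proof.
move=> ws; elim: e => [|e IHe]; first by rewrite actF1.
rewrite expgSr actFM // actF_gen1 ?wf_actF // -IHe.
by case: (actF s _) => [[]].
Qed.

Lemma actF_tower_cons s e es : wf_state s ->
  actF s (tower gen (e :: es))
  = actF (move_right (actF s (gen true ^+ e))) (tower gen es).
Proof.
move=> ws; rewrite /tower -/tower !actFM ?wf_actF //.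
by rewrite actF_gen0V ?wf_actF.
Qed.

Lemma actF_expSr s n : wf_state s ->
  actF s (gen false ^+ n.+1) = move_left (actF s (gen false ^+ n)).
Proof. by move=> ws; rewrite expgSr actFM ?actF_gen0 ?wf_actF. Qed.

Lemma move_left_right s s' : s'.1.1 = (move_right s).1.1 ->
  (move_left s').1 = s.1.
Proof.
case: s s' => [[l c] r] [[l' c'] r'] /= ->.
by rewrite pushK.
Qed.

Lemma actF_tower_left s es : wf_state s ->
  (actF s (tower gen es * gen false ^+ size es)).1.1 = s.1.1.
Proof.
elim: es s => [|e es IHes] s ws; first by rewrite /= mulg1 actF1.
have w1 := wf_actF (gen true ^+ e) ws; have w2 := wf_move_right w1.
rewrite (actFM _ _ ws) actF_tower_cons // actF_expSr ?wf_actF // -actFM //.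
by rewrite (move_left_right (IHes _ w2)) actF_cut_left.
Qed.

(** After the first [e] cuts everything happens to the right of the current tree, so [e] can still
    be read off once the pointer is back. *)
Lemma actF_tower_current s e es : wf_state s ->
  (actF s (tower gen (e :: es) * gen false ^+ (size es).+1)).1
  = (actF s (gen true ^+ e)).1.
Proof.
move=> ws.
have w1 := wf_actF (gen true ^+ e) ws; have w2 := wf_move_right w1.
rewrite (actFM _ _ ws) actF_tower_cons // actF_expSr ?wf_actF // -actFM //.
exact/move_left_right/actF_tower_left.
Qed.

(** On such diagrams every cut of a tower hits a leaf, and its address grows by one turn per cut. *)
Definition leafy (s : state) : bool := is_leaf s.1.2 && all is_leaf s.2.1.

Lemma all_leaf_push d T s :
  is_leaf T -> all is_leaf s.1 -> all is_leaf (push d T s).1.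
Proof. by rewrite /push => lT ls; case: ifP => //= _; rewrite lT. Qed.

Lemma leafy_cut s : leafy s -> leafy (cut s).
Proof.
case: s => [[l [[t u]|//]] r] lr.
by rewrite /leafy /=; apply: all_leaf_push.
Qed.

Lemma leafy_move_right s : leafy s -> leafy (move_right s).
Proof.
case: s => [[l c] [[|T r] n]] //= /and3P[_ lT lr].
by rewrite /leafy /= lT.
Qed.

Lemma leafy_cuts s e : wf_state s -> leafy s -> leafy (actF s (gen true ^+ e)).
Proof.
move=> ws ls; elim: e => [|e IHe]; first by rewrite actF1.
by rewrite expgSr actFM // actF_gen1 ?wf_actF //; apply: leafy_cut.
Qed.

Lemma actF_cut_current s e t u : wf_state s -> s.1.2 = Leaf (t, u) ->
  (actF s (gen true ^+ e)).1.2 = Leaf (t, nseq e false ++ u).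
Proof.
move=> ws su; elim: e => [|e IHe]; first by rewrite actF1.
rewrite expgSr actFM // actF_gen1 ?wf_actF //.
by case: (actF _ _) IHe => [[l c] r] /= ->.
Qed.

Lemma actF_tower_inj s es fs : wf_state s -> leafy s -> size es = size fs ->
  actF s (tower gen es) = actF s (tower gen fs) -> es = fs.
Proof.
elim: es fs s => [|e es IHes] [|f fs] // s ws ls [sz] eq_s.
have ef : e = f.
  have := actF_tower_current e es ws; have := actF_tower_current f fs ws.
  rewrite !(actFM _ (_ ^+ _) ws) eq_s sz => -> /(congr1 snd).
  case: s ws ls {eq_s} => [[l [[t u]|//]] r] ws _.
  rewrite !(@actF_cut_current _ _ t u) // => -[] /(congr1 size).
  by rewrite !size_cat !size_nseq; lia.
move: eq_s; rewrite -ef !actF_tower_cons // => /IHes -> //.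
  exact/wf_move_right/wf_actF.
exact/leafy_move_right/leafy_cuts.
Qed.

Lemma actF_origin_exp a :
  (actF origin (gen false ^+ a)).1.1 = ([::], a)
  /\ leafy (actF origin (gen false ^+ a)).
Proof.
elim: a => [|a [IHl IHf]]; first by rewrite actF1.
rewrite actF_expSr //; case: (actF _ _) IHl IHf => [[l c] r] /= ->.
by case/andP => lc lr; split=> //; rewrite /leafy; apply: all_leaf_push.
Qed.

Lemma actF_free g : actF origin g = origin -> g = 1.
Proof.
have [u <-] := pres_gen_generates g.
have [a [es [b [fs [sz ->]]]]] :=
  normal_fraction thompson_comm1 thompson_comm2 u.
move=> fix_o; have {fix_o} : actF origin (normal_form gen a es)
                             = actF origin (normal_form gen b fs).
  by rewrite -{2}fix_o -actFM // mulgVK.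
have [wa wb] := (wf_actF (gen false ^+ a) wf_origin,
                 wf_actF (gen false ^+ b) wf_origin).
have [[la fa] [lb _]] := (actF_origin_exp a, actF_origin_exp b).
rewrite /normal_form => eq_o.
(* The towers leave the left side alone, and there the power of [gen false] has recorded its
   exponent. *)
have ab : a = b.
  have := congr1 (fun s => s.1.1) eq_o; rewrite -!mulgA !(actFM _ _ wf_origin).
  by rewrite !actF_tower_left // la lb => -[].
move: eq_o; rewrite -ab sz !actFM ?wf_actF // => eq_o.
rewrite (@actF_tower_inj _ es fs wa) ?mulgV //.
rewrite -(actFK (gen false ^+ size fs) (wf_actF _ wa)) eq_o.
by rewrite actFK ?wf_actF.
Qed.

(** * Word length as cost, and the absence of pockets *)

Lemma cost_act_word s u :
  wf_state s -> cost (act_word s u) <= cost s + size u.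
Proof.
elim: u s => [|x u IHu] s ws; first by rewrite addn0.
apply: leq_trans (IHu _ (wf_act x ws)) _.
by have [_ h] := cost_act x ws; rewrite /= addnS -addSn leq_add2r.
Qed.

(** Follow descending generators down to [origin], where freeness gives the identity, and read the
    path backwards. *)
Lemma geodesic v : exists2 u,
  size u + 2 <= cost (act_word origin v) & pi u = pi v :> thompsonF.
Proof.
have [n] := ubnP (cost (act_word origin v)).
elim: n v => // n IHn v; rewrite ltnS => le_n.
have [e|ne] := pselect (act_word origin v = origin).
  exists [::]; first by rewrite e.
  by apply/esym/actF_free; rewrite actF_pi.
have [x cx] := descent (wf_act_word v wf_origin) ne.
have e : act_word origin (rcons v x) = act (act_word origin v) x.
  by rewrite -cats1 act_word_cat.
have [|u su eu] := IHn (rcons v x); first by rewrite e cx.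
exists (rcons u (inv_letter x)); first by rewrite size_rcons addSn -cx -e ltnS.
have xx : pi [:: x] * pi [:: inv_letter x] = 1 :> thompsonF.
  by rewrite -pi_cat; apply/pres_piP/word_eq_cancel.
by rewrite -cats1 pi_cat eu -cats1 pi_cat -[LHS]mulgA xx mulg1.
Qed.

Lemma F_lengthE g : F_length g + 2 = cost (actF origin g).
Proof.
rewrite /F_length /word_length; case: ex_minnP => m /asboolP[u <- ug] min_u.
have {}ug : pi u = g by rewrite -pres_gen_val.
apply/eqP; rewrite eqn_leq; apply/andP; split.
  have [v sv ev] := geodesic (repr g); apply: leq_trans sv.
  rewrite leq_add2r; apply: min_u; apply/asboolP; exists v => //.
  by rewrite pres_gen_val [LHS]ev [LHS]pres_reprK.
by rewrite -ug actF_pi // addnC -cost_origin; apply: cost_act_word.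
Qed.

Lemma F_length_pi u : F_length (pi u) <= size u.
Proof.
rewrite -(leq_add2r 2) F_lengthE actF_pi // addnC -cost_origin.
exact: cost_act_word.
Qed.

Theorem theorem4p3 (k : nat) (hk : (3 <= k)%N) :
  ~ exists w : thompsonF, is_pocket k w.
Proof.
move=> [w [_ pocket]].
have [u su cu] := ascent (wf_actF w wf_origin).
(* This element is within distance 3 of [w], yet it is longer than [w]. *)
have /pocket : F_ball w k (w * pi u).
  by rewrite /F_ball /word_ball /= /word_dist mulKg
    (leq_trans (F_length_pi u)) // (leq_trans su).
rewrite /F_ball /word_ball /= /word_dist invg1 mul1g -/(F_length _).
rewrite -(leq_add2r 2) !F_lengthE actFM // actF_pi ?wf_actF //.
by rewrite leqNgt cu.
Qed.
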